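(* Let $R$ and $S$ be commutative rings such that $S\ge R$ is an almost excellent extension, let $n\ge 0$ be an integer, $M$ an $S$-module and $\mathscr{X}$ a class of submodules of $M$. Then the following statements are equivalent: (1) $M$ is $n$-$\mathscr{X}$-coherent as an $R$-module; (2) $S\otimes_R M$ is an $n$-${}^{S\otimes}\mathscr{X}$-coherent $S$-module; (3) $M$ is $n$-$\mathscr{X}$-coherent as an $S$-module.
   Context: Rings have an identity; modules are unital. For an integer $k\ge 0$, a module $M$ is $k$-presented if there is an exact sequence $F_k\to F_{k-1}\to\cdots\to F_0\to M\to 0$ with each $F_i$ a finitely generated free module (over the ring in question); every module is regarded as $(-1)$-presented. For a class $\mathscr{X}$ of modules, $\mathscr{X}_k$ denotes the class of $k$-presented modules in $\mathscr{X}$. If $\mathscr{X}$ is a class of submodules of a module $M$, then $M$ is $n$-$\mathscr{X}$-coherent if $\mathscr{X}_{n-1}$ is nonempty and every module in $\mathscr{X}_{n-1}$ is in $\mathscr{X}_n$. Here $\mathscr{X}$ is a class of $S$-submodules of $M$, which are also regarded as $R$-submodules in (1). ${}^{S\otimes}\mathscr{X}$ denotes the class $\{S\otimes_R N : N\in\mathscr{X}\}$ of submodules of $S\otimes_R M$. Almost excellent extension: let $S\ge R$ be a unitary ring extension ($R$ a subring of $S$ with the same identity). The ring $S$ is right $R$-projective if for any right $S$-module $M_S$ and any $S$-submodule $N_S$ of it, $N_R\mid M_R$ implies $N_S\mid M_S$, where $N\mid M$ means that $N$ is a direct summand of $M$. The extension is a finite normalizing extension if there is a finite subset $\{s_1,\dots,s_m\}\subseteq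 S$ such that $S=\sum_{i=1}^m s_iR$ and $s_iR=Rs_i$ for all $i$. A finite normalizing extension $S\ge R$ is almost excellent if ${}_RS$ is flat, $S_R$ is projective and $S$ is right $R$-projective. *)

(* Defs.v *)
From HB Require Import structures.
From mathcomp Require Import all_boot all_order all_algebra generic_quotient.
From mathcomp Require Import boolp classical_sets.

Set Implicit Arguments.
Unset Strict Implicit.
Unset Printing Implicit Defensive.

Import GRing.Theory.
Local Open Scope ring_scope.
Local Open Scope quotient_scope.
Local Open Scope classical_set_scope.

(* Rings are [comPzRingType], so the zero ring is allowed, and submodules of   *)
(* [M] are elements of [submodClosed M].                                       *)

Record submod_type (R : pzRingType) (M : lmodType R)
  (N : submodClosed M) : Type := SubmodElt { submod_val : M; _ : submod_val \in N }.

HB.instance Definition _ (R : pzRingType) (M : lmodType R)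
  (N : submodClosed M) := [isSub of submod_type N for @submod_val R M N].
HB.instance Definition _ (R : pzRingType) (M : lmodType R)
  (N : submodClosed M) := [Choice of submod_type N by <:].
HB.instance Definition _ (R : pzRingType) (M : lmodType R)
  (N : submodClosed M) :=
  [SubChoice_isSubLmodule of submod_type N by <:].

Definition direct_summand (R : pzRingType) (M : lmodType R)
    (N : submodClosed M) : Prop :=
  exists N' : submodClosed M,
    (forall x, x \in N -> x \in N' -> x = 0) /\
    (forall x, exists y z, [/\ y \in N, z \in N' & x = y + z]).

Definition fg_free (R : pzRingType) (F : lmodType R) : Prop :=
  exists (n : nat) (g : {linear 'rV[R]_n -> F}), bijective g.

Definition exact (A B C : Type) (c0 : C) (g : A -> B) (h : B -> C) : Prop :=
  range g = h @^-1` [set c0].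

(* Only [F 0, ..., F k] and [d 0, ..., d k.-1] are constrained.                *)
Definition nat_presented (R : pzRingType) (k : nat) (M : lmodType R) : Prop :=
  exists (F : nat -> lmodType R) (d : forall i, {linear F i.+1 -> F i})
         (eps : {linear F 0%N -> M}),
    [/\ forall i, (i <= k)%N -> fg_free (F i),
        range eps = setT,
        (0 < k)%N -> exact 0 (d 0%N) eps
      & forall i, (i.+1 < k)%N -> exact 0 (d i.+1) (d i)].

Definition presented (R : pzRingType) (k : int) (M : lmodType R) : Prop :=
  match k with Posz k => nat_presented k M | Negz _ => True end.

Definition class_presented (R : pzRingType) (M : lmodType R)
    (X : set (submodClosed M)) (k : int) : set (submodClosed M) :=
  [set N | X N /\ presented k (submod_type N)].

Definition coherent (R : pzRingType) (n : nat) (M : lmodType R)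
    (X : set (submodClosed M)) : Prop :=
  class_presented X (n%:Z - 1) !=set0 /\
  class_presented X (n%:Z - 1) `<=` class_presented X n%:Z.

Definition restr (R S : pzRingType) (f : {rmorphism R -> S})
  (M : lmodType S) : Type := M.

HB.instance Definition _ (R S : pzRingType) (f : {rmorphism R -> S})
  (M : lmodType S) := GRing.Zmodule.on (restr f M).

Definition restr_scale (R S : pzRingType) (f : {rmorphism R -> S})
  (M : lmodType S) (r : R) (x : restr f M) : restr f M := f r *: (x : M).

Fact restr_scaleA (R S : pzRingType) (f : {rmorphism R -> S}) (M : lmodType S)
  (a b : R) (v : restr f M) :
  restr_scale a (restr_scale b v) = restr_scale (a * b) v.
Proof. by rewrite /restr_scale scalerA rmorphM. Qed.

Fact restr_scale1 (R S : pzRingType) (f : {rmorphism R -> S})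
  (M : lmodType S) : left_id 1 (@restr_scale R S f M).
Proof. by move=> v; rewrite /restr_scale rmorph1 scale1r. Qed.

Fact restr_scaleDr (R S : pzRingType) (f : {rmorphism R -> S})
  (M : lmodType S) : right_distributive (@restr_scale R S f M) +%R.
Proof. by move=> a u v; rewrite /restr_scale scalerDr. Qed.

Fact restr_scaleDl (R S : pzRingType) (f : {rmorphism R -> S})
  (M : lmodType S) (v : restr f M) :
  {morph (@restr_scale R S f M)^~ v : a b / a + b}.
Proof. by move=> a b; rewrite /restr_scale rmorphD scalerDl. Qed.

HB.instance Definition _ (R S : pzRingType) (f : {rmorphism R -> S})
  (M : lmodType S) := GRing.Zmodule_isLmodule.Build R (restr f M)
    (@restr_scaleA R S f M) (@restr_scale1 R S f M)
    (@restr_scaleDr R S f M) (@restr_scaleDl R S f M).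

Definition restr_sub (R S : pzRingType) (f : {rmorphism R -> S})
  (M : lmodType S) (N : submodClosed M) : {pred restr f M} :=
  fun x : restr f M => (x : M) \in N.

Arguments restr_sub {R S} f {M} N.

Fact restr_sub_closed (R S : pzRingType) (f : {rmorphism R -> S})
  (M : lmodType S) (N : submodClosed M) : submod_closed (restr_sub f N).
Proof.
split=> [|a x y Nx Ny]; first exact: (rpred0 N).
exact: (rpredD (rpredZ (f a) Nx) Ny : f a *: (x : M) + (y : M) \in N).
Qed.

HB.instance Definition _ (R S : pzRingType) (f : {rmorphism R -> S})
  (M : lmodType S) (N : submodClosed M) :=
  GRing.isSubmodClosed.Build R (restr f M) (restr_sub f N)
    (restr_sub_closed f N).

Definition restr_submod (R S : pzRingType) (f : {rmorphism R -> S})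
  (M : lmodType S) (N : submodClosed M) : submodClosed (restr f M) :=
  restr_sub f N.

Arguments restr_submod {R S} f {M} N.

(* The tensor product over a commutative ring [R], as an abelian group: finite *)
(* formal sums of pairs, modulo the least additive congruence making           *)
(* [(p, a)] biadditive and [R]-balanced.  Its universal property is given by   *)
(* [tens_liftD], [tens_lift_pure] and [tens_ind] below.                        *)

Inductive tens_rel (R : comPzRingType) (P A : lmodType R) :
    seq (P * A) -> seq (P * A) -> Prop :=
| TensRefl x : tens_rel x x
| TensSym x y : tens_rel x y -> tens_rel y x
| TensTrans x y z : tens_rel x y -> tens_rel y z -> tens_rel x z
| TensCat x x' y y' :
    tens_rel x x' -> tens_rel y y' -> tens_rel (x ++ y) (x' ++ y')
| TensComm x y : tens_rel (x ++ y) (y ++ x)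
| TensZero a : tens_rel [:: (0, a)] [::]
| TensDl p p' a : tens_rel [:: (p + p', a)] [:: (p, a); (p', a)]
| TensDr p a a' : tens_rel [:: (p, a + a')] [:: (p, a); (p, a')]
| TensBal (r : R) p a : tens_rel [:: (r *: p, a)] [:: (p, r *: a)].

Definition tens_relb (R : comPzRingType) (P A : lmodType R) :
    rel (seq (P * A)) := fun x y => `[< tens_rel x y >].

Fact tens_relb_refl (R : comPzRingType) (P A : lmodType R) :
  reflexive (@tens_relb R P A).
Proof. by move=> x; apply/asboolP; constructor. Qed.

Fact tens_relb_sym (R : comPzRingType) (P A : lmodType R) :
  symmetric (@tens_relb R P A).
Proof. by move=> x y; apply/idP/idP => /asboolP h; apply/asboolP/TensSym. Qed.

Fact tens_relb_trans (R : comPzRingType) (P A : lmodType R) :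
  transitive (@tens_relb R P A).
Proof.
move=> y x z /asboolP xy /asboolP yz; apply/asboolP; exact: TensTrans xy yz.
Qed.

Canonical tens_equiv (R : comPzRingType) (P A : lmodType R) :=
  EquivRel (@tens_relb R P A) (@tens_relb_refl R P A) (@tens_relb_sym R P A)
    (@tens_relb_trans R P A).

Definition tensor (R : comPzRingType) (P A : lmodType R) : Type :=
  {eq_quot (tens_equiv P A)}.

HB.instance Definition _ (R : comPzRingType) (P A : lmodType R) :=
  Choice.on (tensor P A).
HB.instance Definition _ (R : comPzRingType) (P A : lmodType R) :=
  EqQuotient.on (tensor P A).

Lemma tens_eqP (R : comPzRingType) (P A : lmodType R) (x y : seq (P * A)) :
  tens_rel x y <-> \pi_(tensor P A) x = \pi_(tensor P A) y.
Proof.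
split=> [h|/eqmodP/asboolP //]; apply/eqmodP; exact/asboolP.
Qed.

Lemma tens_reprP (R : comPzRingType) (P A : lmodType R) (x : seq (P * A)) :
  tens_rel (repr (\pi_(tensor P A) x)) x.
Proof. by apply/tens_eqP; rewrite reprK. Qed.

Definition tens_zero (R : comPzRingType) (P A : lmodType R) : tensor P A :=
  \pi_(tensor P A) [::].
Definition tens_add (R : comPzRingType) (P A : lmodType R)
  (x y : tensor P A) : tensor P A := \pi_(tensor P A) (repr x ++ repr y).
Definition tens_opp (R : comPzRingType) (P A : lmodType R)
  (x : tensor P A) : tensor P A := \pi_(tensor P A) [seq (- p.1, p.2) | p <- repr x].
Definition pure (R : comPzRingType) (P A : lmodType R) (p : P) (a : A) :
  tensor P A := \pi_(tensor P A) [:: (p, a)].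

Lemma tens_addE (R : comPzRingType) (P A : lmodType R) (x y : seq (P * A)) :
  tens_add (\pi x) (\pi y) = \pi_(tensor P A) (x ++ y).
Proof. by apply/tens_eqP/TensCat; apply: tens_reprP. Qed.

Fact tens_addA (R : comPzRingType) (P A : lmodType R) :
  associative (@tens_add R P A).
Proof. by elim/quotW=> x; elim/quotW=> y; elim/quotW=> z; rewrite !tens_addE catA. Qed.

Fact tens_addC (R : comPzRingType) (P A : lmodType R) :
  commutative (@tens_add R P A).
Proof.
by elim/quotW=> x; elim/quotW=> y; rewrite !tens_addE; apply/tens_eqP/TensComm.
Qed.

Fact tens_add0 (R : comPzRingType) (P A : lmodType R) :
  left_id (tens_zero P A) (@tens_add R P A).
Proof. by elim/quotW=> x; rewrite tens_addE. Qed.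

Fact tens_addN (R : comPzRingType) (P A : lmodType R) :
  left_inverse (tens_zero P A) (@tens_opp R P A) (@tens_add R P A).
Proof.
move=> x; rewrite -{2}[x]reprK /tens_opp tens_addE; apply/tens_eqP.
elim: (repr x) => [|[p a] s IH] /=; first exact: TensRefl.
set s' := map _ s in IH *.
apply: (@TensTrans _ _ _ _ ([:: (- p, a); (p, a)] ++ (s' ++ s))).
  apply: (@TensCat _ _ _ [:: (- p, a)] [:: (- p, a)]
            (s' ++ ([:: (p, a)] ++ s)) ([:: (p, a)] ++ (s' ++ s))).
    exact: TensRefl.
  rewrite !catA; apply: TensCat; [exact: TensComm | exact: TensRefl].
apply: (@TensCat _ _ _ _ [::] _ [::]) => //.
apply: (TensTrans (TensSym (TensDl _ _ _))).
by rewrite addNr; apply: TensZero.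
Qed.

HB.instance Definition _ (R : comPzRingType) (P A : lmodType R) :=
  GRing.isZmodule.Build (tensor P A) (@tens_addA R P A) (@tens_addC R P A)
    (@tens_add0 R P A) (@tens_addN R P A).

Definition balanced (R : comPzRingType) (P A : lmodType R) (Q : zmodType)
    (phi : P -> A -> Q) : Prop :=
  [/\ forall p p' a, phi (p + p') a = phi p a + phi p' a,
      forall p a a', phi p (a + a') = phi p a + phi p a'
    & forall (r : R) p a, phi (r *: p) a = phi p (r *: a)].

Definition tens_lift (R : comPzRingType) (P A : lmodType R) (Q : zmodType)
    (phi : P -> A -> Q) (x : tensor P A) : Q :=
  \sum_(p <- repr x) phi p.1 p.2.

Lemma pure_balanced (R : comPzRingType) (P A : lmodType R) :
  balanced (@pure R P A).
Proof.
split=> *; rewrite /pure -?[LHS]/(\pi _) -?[RHS]/(tens_add (\pi _) (\pi _));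
  rewrite ?tens_addE; apply/tens_eqP; by constructor.
Qed.

Lemma tens_lift_pi (R : comPzRingType) (P A : lmodType R) (Q : zmodType)
    (phi : P -> A -> Q) (s : seq (P * A)) : balanced phi ->
  tens_lift phi (\pi s) = \sum_(p <- s) phi p.1 p.2.
Proof.
move=> [phiDl phiDr phiZ]; rewrite /tens_lift; have := tens_reprP s.
move: (repr _) => t; elim=> {s t}
  [//|x y _ -> //|x y z _ -> _ -> //|x x' y y' _ IH1 _ IH2|x y|a|p p' a|p a a'|r p a].
- by rewrite !big_cat /= IH1 IH2.
- by rewrite !big_cat /= addrC.
- rewrite big_seq1 big_nil /=; apply: (@addrI _ (phi 0 a)).
  by rewrite -phiDl !addr0.
- by rewrite !(big_cons, big_nil) !addr0 /= phiDl.
- by rewrite !(big_cons, big_nil) !addr0 /= phiDr.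
- by rewrite !big_seq1 /= phiZ.
Qed.

Lemma tens_liftD (R : comPzRingType) (P A : lmodType R) (Q : zmodType)
    (phi : P -> A -> Q) : balanced phi ->
  {morph tens_lift phi : x y / x + y}.
Proof.
move=> bal; elim/quotW=> x; elim/quotW=> y.
by rewrite -[_ + _]/(tens_add _ _) tens_addE !tens_lift_pi // big_cat.
Qed.

Lemma tens_lift_pure (R : comPzRingType) (P A : lmodType R) (Q : zmodType)
    (phi : P -> A -> Q) (p : P) (a : A) : balanced phi ->
  tens_lift phi (pure p a) = phi p a.
Proof. by move=> bal; rewrite tens_lift_pi // big_seq1. Qed.

Lemma tens_ind (R : comPzRingType) (P A : lmodType R) (K : tensor P A -> Prop) :
  K 0 -> (forall p a x, K x -> K (pure p a + x)) -> forall x, K x.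
Proof.
move=> K0 KD; elim/quotW; elim=> [//|[p a] s IH].
by have := KD p a _ IH; rewrite -[_ + _]/(tens_add _ _) tens_addE.
Qed.

Definition tens_map (R : comPzRingType) (P A B : lmodType R) (g : A -> B) :
    tensor P A -> tensor P B :=
  tens_lift (fun p a => pure p (g a)).

Lemma tens_map_balanced (R : comPzRingType) (P A B : lmodType R)
  (g : {linear A -> B}) : balanced (fun (p : P) (a : A) => pure p (g a)).
Proof.
have [Dl Dr Z] := pure_balanced P B.
by split=> *; rewrite ?linearD ?linearZ ?(Dl, Dr) ?Z.
Qed.

Definition base_change (R S : comPzRingType) (f : {rmorphism R -> S})
  (M : lmodType S) : Type := @tensor R (restr f S^o) (restr f M).

HB.instance Definition _ (R S : comPzRingType) (f : {rmorphism R -> S})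
  (M : lmodType S) := GRing.Zmodule.on (base_change f M).

Definition bc_pure (R S : comPzRingType) (f : {rmorphism R -> S})
  (M : lmodType S) (s : S) (x : M) : base_change f M :=
  @pure R (restr f S^o) (restr f M) (s : restr f S^o) (x : restr f M).

Arguments bc_pure {R S} f {M} s x.

Definition bc_scale (R S : comPzRingType) (f : {rmorphism R -> S})
    (M : lmodType S) (s : S) : base_change f M -> base_change f M :=
  @tens_lift R (restr f S^o) (restr f M) _ (fun (t : restr f S^o) (x : restr f M) => bc_pure f (s * t) x).

Lemma bc_scale_balanced (R S : comPzRingType) (f : {rmorphism R -> S})
  (M : lmodType S) (s : S) :
  @balanced R (restr f S^o) (restr f _) _ (fun (t : restr f S^o) (x : restr f M) => bc_pure f (s * t) x).
Proof.
have [Dl Dr Z] := @pure_balanced R (restr f S^o) (restr f M).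
split=> [t t' x|t x x'|r t x].
- by rewrite -Dl; congr pure; apply: mulrDr.
- exact: Dr.
- rewrite /bc_pure -Z; congr pure; exact: mulrCA.
Qed.

Lemma bc_scale_pure (R S : comPzRingType) (f : {rmorphism R -> S})
  (M : lmodType S) (s t : S) (x : M) :
  bc_scale s (bc_pure f t x) = bc_pure f (s * t) x.
Proof. by rewrite /bc_scale tens_lift_pure //; apply: bc_scale_balanced. Qed.

Fact bc_scaleDr (R S : comPzRingType) (f : {rmorphism R -> S})
  (M : lmodType S) : right_distributive (@bc_scale R S f M) +%R.
Proof. by move=> s; apply/tens_liftD/bc_scale_balanced. Qed.

Fact bc_scale0 (R S : comPzRingType) (f : {rmorphism R -> S})
  (M : lmodType S) s : bc_scale s (0 : base_change f M) = 0.
Proof.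
by apply: (@addrI _ (bc_scale s (0 : base_change f M))); rewrite -bc_scaleDr !addr0.
Qed.

Lemma bc_ind (R S : comPzRingType) (f : {rmorphism R -> S}) (M : lmodType S)
    (K : base_change f M -> Prop) :
  K 0 -> (forall s m x, K x -> K (bc_pure f s m + x)) -> forall x, K x.
Proof. exact: (@tens_ind R (restr f S^o) (restr f M) K). Qed.

Fact bc_scaleA (R S : comPzRingType) (f : {rmorphism R -> S})
  (M : lmodType S) (s t : S) (x : base_change f M) :
  bc_scale s (bc_scale t x) = bc_scale (s * t) x.
Proof.
elim/bc_ind: x => [|u m x IH]; first by rewrite !bc_scale0.
by rewrite !bc_scaleDr IH !bc_scale_pure mulrA.
Qed.

Fact bc_scale1 (R S : comPzRingType) (f : {rmorphism R -> S})
  (M : lmodType S) : left_id 1 (@bc_scale R S f M).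
Proof.
elim/bc_ind=> [|u m x IH]; first by rewrite !bc_scale0.
by rewrite !bc_scaleDr IH !bc_scale_pure mul1r.
Qed.

Fact bc_scaleDl (R S : comPzRingType) (f : {rmorphism R -> S})
  (M : lmodType S) (x : base_change f M) :
  {morph (@bc_scale R S f M)^~ x : s t / s + t}.
Proof.
move=> s t; elim/bc_ind: x => [|u m x IH]; first by rewrite !bc_scale0 addr0.
rewrite !bc_scaleDr IH !bc_scale_pure addrACA; congr (_ + _).
have [Dl _ _] := @pure_balanced R (restr f S^o) (restr f M).
by rewrite -Dl; congr pure; apply: mulrDl.
Qed.

HB.instance Definition _ (R S : comPzRingType) (f : {rmorphism R -> S})
  (M : lmodType S) := GRing.Zmodule_isLmodule.Build S (base_change f M)
    (@bc_scaleA R S f M) (@bc_scale1 R S f M)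
    (@bc_scaleDr R S f M) (@bc_scaleDl R S f M).

Definition bc_map (R S : comPzRingType) (f : {rmorphism R -> S})
    (M M' : lmodType S) (g : M -> M') : base_change f M -> base_change f M' :=
  @tens_map R (restr f S^o) (restr f M) (restr f M') g.

Arguments bc_map {R S} f {M M'} g.

Fact bc_map_linear (R S : comPzRingType) (f : {rmorphism R -> S})
  (M M' : lmodType S) (g : {linear M -> M'}) : linear (bc_map f g).
Proof.
have bal : @balanced R (restr f S^o) (restr f _) _ (fun (t : restr f S^o) (x : restr f M) => bc_pure f t (g x)).
  have [Dl Dr Z] := @pure_balanced R (restr f S^o) (restr f M').
  split=> [t t' x|t x x'|r t x]; first exact: Dl.
  - by rewrite -Dr; congr pure; apply: linearD.
  - by rewrite /bc_pure Z; congr pure; rewrite [RHS]linearZ.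
have gD : {morph bc_map f g : x y / x + y} by apply: tens_liftD.
have g0 : bc_map f g 0 = 0.
  by apply: (@addrI _ (bc_map f g 0)); rewrite -gD !addr0.
have gp t x : bc_map f g (bc_pure f t x) = bc_pure f t (g x).
  by rewrite /bc_map /tens_map tens_lift_pure.
move=> s x y; rewrite gD; congr (_ + _).
elim/bc_ind: x => [|u m x IH]; first by rewrite scaler0 g0 scaler0.
rewrite scalerDr !gD IH scalerDr; congr (_ + _).
by rewrite -![s *: _]/(bc_scale _ _) gp !bc_scale_pure gp.
Qed.

(* The tensor product of [S] and [N] seen inside that of [S] and [M], as the   *)
(* image of the canonical map; this map is injective when [S] is flat over [R]. *)
Definition bc_sub (R S : comPzRingType) (f : {rmorphism R -> S})
    (M : lmodType S) (N : submodClosed M) : {pred base_change f M} :=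
  fun t => `[< range (bc_map f (val : submod_type N -> M)) t >].

Arguments bc_sub {R S} f {M} N.

Fact bc_sub_closed (R S : comPzRingType) (f : {rmorphism R -> S})
  (M : lmodType S) (N : submodClosed M) : submod_closed (bc_sub f N).
Proof.
pose g : {linear submod_type N -> M} := val.
split=> [|s _ _ /asboolP[x _ <-] /asboolP[y _ <-]]; apply/asboolP.
  exists 0 => //; have := @bc_map_linear R S f _ _ g (-1) 0 0.
  by rewrite scaler0 addr0 scaleN1r addNr.
by exists (s *: x + y) => //; apply: (@bc_map_linear R S f _ _ g).
Qed.

HB.instance Definition _ (R S : comPzRingType) (f : {rmorphism R -> S})
  (M : lmodType S) (N : submodClosed M) :=
  GRing.isSubmodClosed.Build S (base_change f M) (bc_sub f N)
    (bc_sub_closed f N).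

Definition bc_submod (R S : comPzRingType) (f : {rmorphism R -> S})
  (M : lmodType S) (N : submodClosed M) : submodClosed (base_change f M) :=
  bc_sub f N.

Arguments bc_submod {R S} f {M} N.

Definition restr_class (R S : pzRingType) (f : {rmorphism R -> S})
    (M : lmodType S) (X : set (submodClosed M)) :
    set (submodClosed (restr f M)) :=
  restr_submod f @` X.

Definition bc_class (R S : comPzRingType) (f : {rmorphism R -> S})
    (M : lmodType S) (X : set (submodClosed M)) :
    set (submodClosed (base_change f M)) :=
  bc_submod f @` X.

Arguments restr_class {R S} f {M} X.
Arguments bc_class {R S} f {M} X.

Definition flat (R : comPzRingType) (P : lmodType R) : Prop :=
  forall (A B : lmodType R) (g : {linear A -> B}), injective g ->
    injective (@tens_map R P A B g).

Definition projective (R : pzRingType) (P : lmodType R) : Prop :=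
  forall (A B : lmodType R) (g : {linear A -> B}) (h : {linear P -> B}),
    range g = setT ->
    exists h' : {linear P -> A}, forall x, g (h' x) = h x.

Definition relatively_projective (R S : comPzRingType)
    (f : {rmorphism R -> S}) : Prop :=
  forall (M : lmodType S) (N : submodClosed M),
    direct_summand (restr_submod f N) -> direct_summand N.

Definition finite_normalizing (R S : pzRingType) (f : {rmorphism R -> S}) :
    Prop :=
  exists (m : nat) (s : 'I_m -> S),
    (forall x, exists r : 'I_m -> R, x = \sum_(i < m) s i * f (r i)) /\
    (forall i, range (fun r => s i * f r) = range (fun r => f r * s i)).

(* The inclusion of [R] in [S] is an injective ring morphism [f].  Both rings  *)
(* being commutative, left and right modules are the same.                     *)
Definition almost_excellent (R S : comPzRingType) (f : {rmorphism R -> S}) :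
    Prop :=
  [/\ injective f, finite_normalizing f, @flat R (restr f S^o),
      @projective R (restr f S^o) & relatively_projective f].

(* Main.v *)
(* Over R, the ring S is a retract of some R^m. For an S-module N this makes   *)
(* restriction preserve and reflect k-presentedness, by induction on k through *)
(* a surjection S^p -> N and its kernel. Moreover N is an R-retract of         *)
(* S (x) N, which is itself an R-retract of N^m, and retracts inherit          *)
(* k-presentedness. Hence N over R, N over S and S (x) N over S are            *)
(* k-presented for the same k.                                                 *)
Require Import Defs.
From HB Require Import structures.
From mathcomp Require Import all_boot all_order all_algebra.
From mathcomp Require Import boolp classical_sets.

Set Implicit Arguments.
Unset Strict Implicit.
Unset Printing Implicit Defensive.

Import GRing.Theory.
Local Open Scope ring_scope.

(** Over a fixed ring, k-presentedness is read recursively: some surjection from a finite free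
    module has a (k-1)-presented kernel ([ker_presented]; the two forms agree by [nat_presentedP]).
    The horseshoe argument gives its behaviour on short exact sequences: [ker_presented_ext],
    [ker_presented_quot] and [ker_presented_ker], together with the passage to retracts,
    [ker_presented_retract].

    Finite generation and projectivity make S an R-retract of some R^m ([coordinates]), so S is
    k-presented over R for every k, and an S-module is k-presented over S exactly when it is so over
    R ([ker_presented_restr]). Tensoring the retraction with N makes S (x) N an R-retract of N^m,
    while N is an R-retract of S (x) N through 1 (x) x and the action map; this is
    [ker_presented_bc]. Flatness identifies S (x) N with its image in S (x) M
    ([ker_presented_bc_submod]). Coherence of a class depends only on the presentedness of its
    members, so it passes to and from the image class ([coherent_image]). *)

Definition surj (A B : Type) (g : A -> B) : Prop := forall y, exists x, g x = y.

Lemma range_setT (A B : Type) (g : A -> B) : range g = setT <-> surj g.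
Proof.
split=> [h y|h]; first by have [x _ <-] : range g y; [by rewrite h|exists x].
by apply/seteqP; split=> // y _; have [x <-] := h y; exists x.
Qed.

Lemma exactP (A B C : Type) (c0 : C) (g : A -> B) (h : B -> C) :
  exact c0 g h <-> forall x, h x = c0 <-> exists y, g y = x.
Proof.
rewrite /exact; split=> [e x|e].
  have -> : (h x = c0) = range g x by rewrite e.
  by split=> [[y _ <-]|[y <-]]; exists y.
apply/seteqP; split=> x; first by move=> [y _ <-]; apply/e; exists y.
by move=> /e[y <-]; exists y.
Qed.

(** * Presentedness over one ring, by iterated kernels *)

Section LinearMaps.
Context {R : pzRingType}.

Definition mklin (A B : lmodType R) (g : A -> B) (h : linear g) :
  {linear A -> B} := HB.pack g (GRing.isLinear.Build R A B *:%R g h).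

Definition ker_pred (A B : lmodType R) (g : {linear A -> B}) : {pred A} :=
  fun x => g x == 0.

Fact ker_pred_closed (A B : lmodType R) (g : {linear A -> B}) :
  submod_closed (ker_pred g).
Proof.
split=> [|a x y]; rewrite !unfold_in; first by rewrite linear0.
by move=> /eqP hx /eqP hy; rewrite linearP hx hy scaler0 addr0.
Qed.

HB.instance Definition _ (A B : lmodType R) (g : {linear A -> B}) :=
  GRing.isSubmodClosed.Build R A (ker_pred g) (ker_pred_closed g).

Definition ker (A B : lmodType R) (g : {linear A -> B}) : lmodType R :=
  submod_type (ker_pred g : submodClosed A).

Definition ker_incl (A B : lmodType R) (g : {linear A -> B}) :
  {linear ker g -> A} := (val : submod_type (ker_pred g : submodClosed A) -> A).

Lemma ker_inclK (A B : lmodType R) (g : {linear A -> B}) x :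
  g (ker_incl g x) = 0.
Proof. by apply/eqP; exact: (valP x). Qed.

Lemma ker_incl_inj (A B : lmodType R) (g : {linear A -> B}) :
  injective (ker_incl g).
Proof. exact: val_inj. Qed.

Lemma ker_incl_ex (A B : lmodType R) (g : {linear A -> B}) x :
  g x = 0 -> exists y, ker_incl g y = x.
Proof.
move=> /eqP gx.
by exists (@SubmodElt R A (ker_pred g : submodClosed A) x gx).
Qed.

Definition short_exact (A B C : lmodType R) (i : {linear A -> B})
  (p : {linear B -> C}) : Prop :=
  [/\ injective i, surj p & forall x, p x = 0 <-> exists a, i a = x].

Lemma ker_short_exact (B C : lmodType R) (p : {linear B -> C}) :
  surj p -> short_exact (ker_incl p) p.
Proof.
move=> ps; split=> // [|x]; first exact: ker_incl_inj.
by split=> [/ker_incl_ex//|[a <-]]; exact: ker_inclK.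
Qed.

(** Choose preimages under [i]; injectivity forces the choice to be linear. Since a kernel is a type
    of its own, all maps into kernels are built this way. *)
Lemma linear_factor (A B D : lmodType R) (i : {linear A -> B})
    (q : {linear D -> B}) :
  injective i -> (forall x, exists a, i a = q x) ->
  exists q' : {linear D -> A}, forall x, i (q' x) = q x.
Proof.
move=> ii h; have [q' hq'] := choice h.
suff l : linear q' by exists (mklin l).
by move=> a x y; apply: ii; rewrite linearP !hq' linearP.
Qed.

Definition lincomb (A : lmodType R) (n : nat) (b : 'I_n -> A) (v : 'rV[R]_n) :
  A := \sum_i v 0 i *: b i.

Fact lincomb_linear (A : lmodType R) n (b : 'I_n -> A) : linear (lincomb b).
Proof.
move=> a x y; rewrite /lincomb scaler_sumr -big_split; apply: eq_bigr => i _.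
by rewrite !mxE scalerDl scalerA.
Qed.

HB.instance Definition _ (A : lmodType R) n (b : 'I_n -> A) :=
  GRing.isLinear.Build R 'rV[R]_n A *:%R (lincomb b) (lincomb_linear b).

Lemma linear_lincomb (A : lmodType R) n (g : {linear 'rV[R]_n -> A}) v :
  g v = lincomb (fun i => g (delta_mx 0 i)) v.
Proof.
rewrite {1}[v]row_sum_delta linear_sum.
by apply: eq_bigr => i _; rewrite linearZ.
Qed.

Lemma free_lift (B C : lmodType R) n (p : {linear B -> C})
    (g : {linear 'rV[R]_n -> C}) :
  surj p -> exists h : {linear 'rV[R]_n -> B}, forall v, p (h v) = g v.
Proof.
move=> ps; have [b hb] := choice (fun i => ps (g (delta_mx 0 i))).
exists (lincomb b) => v; rewrite [RHS]linear_lincomb linear_sum.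
by apply: eq_bigr => i _; rewrite linearZ /= hb.
Qed.

(** Syzygy form of k-presentedness, suited to induction on [k]. One good surjection is required at
    each stage, not all of them. *)
Fixpoint ker_presented (k : nat) (M : lmodType R) : Prop :=
  exists n (g : {linear 'rV[R]_n -> M}),
    surj g /\ if k is k'.+1 then ker_presented k' (ker g) else True.

Lemma ker_presented_fg k M : ker_presented k M ->
  exists n (g : {linear 'rV[R]_n -> M}), surj g.
Proof. by case: k => [|k] [n [g [gs _]]]; exists n, g. Qed.

Lemma ker_presented_pred k M : ker_presented k.+1 M -> ker_presented k M.
Proof.
elim: k M => [|k IH] M [n [g [gs h]]]; exists n, g; split=> //.
exact: IH.
Qed.

Lemma ker_presented_triv k (M : lmodType R) :
  (forall x : M, x = 0) -> ker_presented k M.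
Proof.
elim: k M => [|k IH] M M0; exists 0%N, (\0 : {linear 'rV[R]_0 -> M}).
  by split=> // x; exists 0; rewrite [RHS]M0.
split=> [x|]; first by exists 0; rewrite [RHS]M0.
apply: IH => x; apply: ker_incl_inj; apply/rowP; case=> //.
Qed.

Lemma ker_presented_free k n : ker_presented k 'rV[R]_n.
Proof.
have ids : surj (idfun : 'rV[R]_n -> 'rV[R]_n) by move=> x; exists x.
case: k => [|k]; exists n, idfun; split=> //.
apply: ker_presented_triv => x; apply: ker_incl_inj.
exact: (ker_inclK x).
Qed.

(** Lift [c] through [p] to [h] and let [q] send [(u, v)] to [i (a u) + h v]. Then [j] and [r] are
    the block inclusion and the block projection, restricted to kernels. *)
Lemma horseshoe (A B C : lmodType R) (i : {linear A -> B})
    (p : {linear B -> C}) m n (a : {linear 'rV[R]_m -> A})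
    (c : {linear 'rV[R]_n -> C}) : short_exact i p -> surj a -> surj c ->
  exists q : {linear 'rV[R]_(m + n) -> B}, surj q /\
    exists (j : {linear ker a -> ker q}) (r : {linear ker q -> ker c}),
      short_exact j r.
Proof.
move=> [ii ps ex] asurj csurj.
have [h ph] := free_lift c ps.
have ql : linear (fun v : 'rV[R]_(m + n) => i (a (lsubmx v)) + h (rsubmx v)).
  by move=> t x y; rewrite !linearP /= scalerDr addrACA.
pose q := mklin ql.
have qE x y : q (row_mx x y) = i (a x) + h y by rewrite /= row_mxKl row_mxKr.
have pi x : p (i x) = 0 by apply/ex; exists x.
have pq v : p (q v) = c (rsubmx v) by rewrite /= linearD pi add0r ph.
exists q; split.
  move=> y; have [v cv] := csurj (p y).
  have [x hx] : exists x, i x = y - h v by apply/ex; rewrite linearB ph cv subrr.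
  by have [u au] := asurj x; exists (row_mx u v); rewrite qE au hx subrK.
have j0l : linear (fun x : ker a => row_mx (ker_incl a x) 0 : 'rV[R]_(m + n)).
  by move=> t x y; rewrite linearP scale_row_mx add_row_mx scaler0 addr0.
have [j hj] : exists j : {linear ker a -> ker q},
    forall x, ker_incl q (j x) = row_mx (ker_incl a x) 0.
  apply: (linear_factor (q := mklin j0l)); first exact: ker_incl_inj.
  by move=> x; apply: ker_incl_ex; rewrite qE ker_inclK !linear0 addr0.
have r0l : linear (fun x : ker q => rsubmx (ker_incl q x)).
  by move=> t x y; rewrite !linearP.
have [r hr] : exists r : {linear ker q -> ker c},
    forall x, ker_incl c (r x) = rsubmx (ker_incl q x).
  apply: (linear_factor (q := mklin r0l)); first exact: ker_incl_inj.
  by move=> x; apply: ker_incl_ex; rewrite -pq ker_inclK linear0.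
exists j, r; split.
- move=> x y /(congr1 (ker_incl _)); rewrite !hj => /(congr1 lsubmx).
  by rewrite !row_mxKl; apply: ker_incl_inj.
(* Since [p (h y) = c y = 0], the vector [h y] comes from [A]; the block [u] is chosen to cancel it,
   so that [row_mx u y] lies in [ker q]. *)
- move=> y; have [x hx] : exists x, i x = - h (ker_incl c y).
    by apply/ex; rewrite linearN ph ker_inclK oppr0.
  have [u au] := asurj x.
  have [z hz] : exists z, ker_incl q z = row_mx u (ker_incl c y).
    by apply: ker_incl_ex; rewrite qE au hx addNr.
  by exists z; apply: ker_incl_inj; rewrite hr hz row_mxKr.
- move=> x; split=> [rx|[y <-]]; last first.
    by apply: ker_incl_inj; rewrite hr hj row_mxKr linear0.
  have rx0 : rsubmx (ker_incl q x) = 0 by rewrite -hr rx linear0.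
  have [y hy] : exists y, ker_incl a y = lsubmx (ker_incl q x).
    apply: ker_incl_ex; apply: ii; rewrite linear0.
    by have := ker_inclK x; rewrite -[ker_incl q x]hsubmxK qE rx0 linear0 addr0
      row_mxKl.
  by exists y; apply: ker_incl_inj; rewrite hj hy -rx0 hsubmxK.
Qed.

(** The kernels supplied by the horseshoe form a short exact sequence again, so induction on [k]
    applies to them. *)
Lemma ker_presented_ext k (A B C : lmodType R) (i : {linear A -> B})
    (p : {linear B -> C}) : short_exact i p ->
  ker_presented k A -> ker_presented k C -> ker_presented k B.
Proof.
elim: k A B C i p => [|k IH] A B C i p ex [m [a [asurj hA]]] [n [c [csurj hC]]];
  have [q [qs [j [r jr]]]] := horseshoe ex asurj csurj;
  exists (m + n)%N, q; split=> //.
exact: IH jr hA hC.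
Qed.

Lemma ker_presented0_quot (B C : lmodType R) (p : {linear B -> C}) :
  surj p -> ker_presented 0 B -> ker_presented 0 C.
Proof.
move=> ps [n [g [gs _]]]; exists n, (p \o g); split=> // y.
by have [x <-] := ps y; have [v <-] := gs x; exists v.
Qed.

(** For a good surjection [g] onto [B], the kernel of [p \o g] is an extension of [A] by [ker g],
    both k-presented. *)
Lemma ker_presented_quot k (A B C : lmodType R) (i : {linear A -> B})
    (p : {linear B -> C}) : short_exact i p ->
  ker_presented k A -> ker_presented k.+1 B -> ker_presented k.+1 C.
Proof.
move=> [ii ps ex] hA [n [g [gs hK]]]; exists n, (p \o g); split.
  by move=> y; have [x <-] := ps y; have [v <-] := gs x; exists v.
pose K := ker (p \o g).
have pgK (x : K) : p (g (ker_incl _ x)) = 0 by exact: (ker_inclK x).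
have pi x : p (i x) = 0 by apply/ex; exists x.
have [j hj] : exists j : {linear ker g -> K},
    forall x, ker_incl _ (j x) = ker_incl g x.
  apply: linear_factor; first exact: ker_incl_inj.
  by move=> x; apply: ker_incl_ex; rewrite /= ker_inclK linear0.
have [r hr] : exists r : {linear K -> A}, forall x, i (r x) = g (ker_incl _ x).
  by apply: (linear_factor (q := g \o ker_incl _)) => // x; apply/ex/pgK.
apply: (ker_presented_ext (i := j) (p := r)) hK hA; split.
- by move=> x y /(congr1 (ker_incl _)); rewrite !hj; apply: ker_incl_inj.
- move=> y; have [v gv] := gs (i y).
  have [z hz] : exists z, ker_incl (p \o g) z = v.
    by apply: ker_incl_ex; rewrite /= gv pi.
  by exists z; apply: ii; rewrite hr hz.
- move=> x; split=> [rx|[y <-]].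
    have [y hy] : exists y, ker_incl g y = ker_incl (p \o g) x.
      by apply: ker_incl_ex; rewrite -hr rx linear0.
    by exists y; apply: ker_incl_inj; rewrite hj.
  by apply: ii; rewrite hr hj ker_inclK linear0.
Qed.

Lemma ker_presented_retract k (A L : lmodType R) (s : {linear A -> L})
    (r : {linear L -> A}) :
  cancel s r -> ker_presented k L -> ker_presented k A.
Proof.
elim: k A L s r => [|k IH] A L s r sK.
all: have rs : surj r by move=> x; exists (s x).
  exact: ker_presented0_quot.
move=> hL; apply: (ker_presented_quot (ker_short_exact rs)) => //.
(* The complementary projection makes [ker r] a retract of [L] as well, so the induction hypothesis
   covers it and the quotient rule yields [A]. *)
have [t ht] : exists t : {linear L -> ker r},
    forall x, ker_incl r (t x) = x - s (r x).
  have l : linear (fun x => x - s (r x)).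
    by move=> a x y; rewrite !linearP /= scalerBr scalerN addrACA.
  apply: (linear_factor (q := mklin l)); first exact: ker_incl_inj.
  by move=> x; apply: ker_incl_ex; rewrite linearB /= sK subrr.
apply: (IH _ L (ker_incl r) t) (ker_presented_pred hL) => x.
by apply: ker_incl_inj; rewrite ht ker_inclK linear0 subr0.
Qed.

Lemma ker_presented_iso k (A B : lmodType R) (u : {linear A -> B}) :
  injective u -> surj u -> ker_presented k A <-> ker_presented k B.
Proof.
move=> ui us; have [v hv] := linear_factor (q := idfun) ui us.
split; [apply: (ker_presented_retract (s := v) (r := u))|
        apply: (ker_presented_retract (s := u) (r := v))] => // x.
by apply: ui; rewrite hv.
Qed.

(** A Schanuel-type argument: with [h] lifting [g] through [p], the map [i + h] from [A * R^n] onto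
    [B] has kernel a copy of [ker g]. Hence [A * R^n] is k-presented, and [A] is a retract of it. *)
Lemma ker_presented_ker k (A B C : lmodType R) (i : {linear A -> B})
    (p : {linear B -> C}) : short_exact i p ->
  ker_presented k B -> ker_presented k.+1 C -> ker_presented k A.
Proof.
move=> [ii ps ex] hB [n [g [gs hK]]].
have [h ph] := free_lift g ps.
have pi x : p (i x) = 0 by apply/ex; exists x.
have [t ht] : exists t : {linear ker g -> A},
    forall x, i (t x) = h (ker_incl g x).
  apply: (linear_factor (q := h \o ker_incl g)) => // x.
  by apply/ex; rewrite /= ph ker_inclK.
(* The kernel of [i + h : A * R^n -> B] is that of [g]. *)
have jl : linear (fun x : ker g => (- t x, ker_incl g x)).
  by move=> a x y; rewrite !linearP.
have ql : linear (fun x : A * 'rV[R]_n => i x.1 + h x.2).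
  by move=> a x y; rewrite !linearP /= scalerDr addrACA.
have sl : linear (fun x : A => (x, 0 : 'rV[R]_n)).
  move=> a x y.
  by rewrite -[RHS]/(a *: x + y, a *: (0 : 'rV[R]_n) + 0) scaler0 addr0.
have rl : linear (fst : A * 'rV[R]_n -> A) by [].
apply: (ker_presented_retract (s := mklin sl) (r := mklin rl)) => //.
apply: (ker_presented_ext (i := mklin jl) (p := mklin ql)) hK hB; split.
- by move=> x y [_]; apply: ker_incl_inj.
- move=> y; have [v gv] := gs (p y).
  have [x hx] : exists x, i x = y - h v by apply/ex; rewrite linearB ph gv subrr.
  by exists (x, v); rewrite /= hx subrK.
- move=> [x v] /=; split=> [e|[y [<- <-]]]; last by rewrite linearN ht addNr.
  have [y hy] : exists y, ker_incl g y = v.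
    apply: ker_incl_ex; rewrite -ph -[LHS]add0r -(pi x) -linearD e linear0 //.
  exists y; congr pair => //; apply: ii.
  by rewrite linearN ht hy; apply/eqP; rewrite eq_sym -addr_eq0 e.
Qed.

(** Splitting off coordinate 0 shows the power of exponent m+1 as an extension of the power of
    exponent m by [A]. *)
Lemma ker_presented_ffun k m (A : lmodType R) :
  ker_presented k A -> ker_presented k {ffun 'I_m -> A}.
Proof.
move=> hA; elim: m => [|m IH].
  by apply: ker_presented_triv => x; apply/ffunP; case.
have il : linear (fun a : A => [ffun i : 'I_m.+1 => if i == 0 then a else 0]).
  move=> t x y; apply/ffunP => i; rewrite !ffunE.
  by case: eqP => //; rewrite scaler0 addr0.
have pl : linear (fun v : {ffun 'I_m.+1 -> A} =>
    [ffun i : 'I_m => v (lift ord0 i)]).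
  by move=> t x y; apply/ffunP => i; rewrite !ffunE.
apply: (ker_presented_ext (i := mklin il) (p := mklin pl)) hA IH; split.
- by move=> x y /ffunP/(_ 0); rewrite !ffunE.
- move=> v; exists [ffun i => if unlift ord0 i is Some j then v j else 0].
  by apply/ffunP => i; rewrite !ffunE liftK.
- move=> v; split=> [/ffunP e|[a <-]]; last first.
    by apply/ffunP => i; rewrite !ffunE.
  exists (v 0); apply/ffunP => i; rewrite ffunE.
  case: (unliftP ord0 i) => [j ->|->//].
  by have := e j; rewrite !ffunE.
Qed.

(** * Comparison with free resolutions *)

Lemma nat_presented_ker k (M : lmodType R) :
  nat_presented k M -> ker_presented k M.
Proof.
elim: k M => [|k IH] M [F [d [e [Ff /range_setT es e0 ed]]]];
  have [n [g [g' gK g'K]]] := Ff 0%N isT;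
  have egs : surj (e \o g) by [
    move=> y; have [x <-] := es y; exists (g' x); rewrite /= g'K];
  exists n, (e \o g); split=> //.
have {}e0 := (exactP _ _ _).1 (e0 isT).
have [d0 hd0] : exists d0 : {linear F 1%N -> ker e},
    forall x, ker_incl e (d0 x) = d 0%N x.
  apply: linear_factor; first exact: ker_incl_inj.
  by move=> x; apply: ker_incl_ex; apply/e0; exists x.
(* The resolution shifted by one step resolves [ker e], with [d0] as augmentation. *)
have hK : ker_presented k (ker e).
  apply: IH; exists (fun i => F i.+1), (fun i => d i.+1), d0; split.
  - by move=> i ik; exact: Ff.
  - apply/range_setT => y.
    have [x hx] := (e0 (ker_incl e y)).1 (ker_inclK y).
    by exists x; apply: ker_incl_inj; rewrite hd0.
  - move=> k0; apply/exactP => x.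
    rewrite -((exactP _ _ _).1 (ed 0%N k0)) -hd0.
    split=> [->|h]; first by rewrite linear0.
    by apply: ker_incl_inj; rewrite h linear0.
  - by move=> i ik; exact: (ed i.+1).
(* Only the identification of [F 0] with R^n remains: [g] restricts to an isomorphism from
   [ker (e \o g)] to [ker e]. *)
have [u hu] : exists u : {linear ker (e \o g) -> ker e},
    forall x, ker_incl e (u x) = g (ker_incl _ x).
  apply: (linear_factor (q := g \o ker_incl _)); first exact: ker_incl_inj.
  by move=> x; apply: ker_incl_ex; exact: (ker_inclK x).
apply: (proj2 (ker_presented_iso _ (u := u) _ _)) hK.
  move=> x y /(congr1 (ker_incl e)); rewrite !hu => /(can_inj gK).
  exact: ker_incl_inj.
move=> y; have [x hx] : exists x, ker_incl (e \o g) x = g' (ker_incl e y).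
  by apply: ker_incl_ex; rewrite /= g'K ker_inclK.
by exists x; apply: ker_incl_inj; rewrite hu hx g'K.
Qed.

Lemma ker_presented_nat k (M : lmodType R) :
  ker_presented k M -> nat_presented k M.
Proof.
have free n : fg_free 'rV[R]_n by exists n, idfun; exists idfun.
elim: k M => [|k IH] M [n [g [gs h]]].
  exists (fun=> 'rV[R]_n), (fun=> \0), g; split=> //.
  exact/range_setT.
have [F [d [e [Ff /range_setT es e0 ed]]]] := IH _ h.
(* Splicing: R^n is put in front, and the new lowest differential is the augmentation onto [ker g]
   followed by its inclusion. *)
pose F' i : lmodType R := if i is i'.+1 then F i' else 'rV[R]_n.
pose d' i : {linear F' i.+1 -> F' i} :=
  match i return {linear F' i.+1 -> F' i} with
  | 0%N => ker_incl g \o e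
  | i'.+1 => d i'
  end.
exists F', d', g; split.
- by case=> [_|i ik]; [exact: free|exact: Ff].
- exact/range_setT.
- move=> _; apply/exactP => x; split=> [/ker_incl_ex[y <-]|[y <-]].
    by have [z <-] := es y; exists z.
  exact: ker_inclK.
- case=> [k0|i ik]; last exact: ed.
  apply/exactP => x; rewrite -((exactP _ _ _).1 (e0 k0)).
  split=> [hx|ex]; last first.
    exact: etrans (congr1 (ker_incl g) ex) (linear0 _).
  by apply: ker_incl_inj; rewrite [LHS]hx linear0.
Qed.

Lemma nat_presentedP k (M : lmodType R) : nat_presented k M <-> ker_presented k M.
Proof. by split; [exact: nat_presented_ker|exact: ker_presented_nat]. Qed.

End LinearMaps.

(** * Restriction of scalars *)

Section Restriction.
Context {R S : pzRingType} (f : {rmorphism R -> S}).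

Fact restr_map_linear (A B : lmodType S) (g : {linear A -> B}) :
  linear (g : restr f A -> restr f B).
Proof. by move=> r x y; exact: (linearP g (f r)). Qed.

Definition restr_map (A B : lmodType S) (g : {linear A -> B}) :
  {linear restr f A -> restr f B} := mklin (restr_map_linear g).

(** Restriction keeps the underlying types, maps and zeros, so the two statements are
    convertible. *)
Lemma restr_short_exact (A B C : lmodType S) (i : {linear A -> B})
    (p : {linear B -> C}) :
  short_exact i p -> short_exact (restr_map i) (restr_map p).
Proof. by []. Qed.

Hypothesis S_pres : forall k, @ker_presented R k (restr f S^o).

Lemma ker_presented_restr_free k n : ker_presented k (restr f 'rV[S]_n).
Proof.
have sl : linear (fun v : restr f 'rV[S]_n =>
    [ffun i => (v : 'rV[S]_n) 0 i : restr f S^o]).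
  by move=> t x y; apply/ffunP => i; rewrite !ffunE [LHS]mxE mxE.
have rl : linear (fun v : {ffun 'I_n -> restr f S^o} =>
    (\row_i v i : 'rV[S]_n) : restr f 'rV[S]_n).
  move=> t x y; apply/rowP => i; rewrite [LHS]mxE ffunE ffunE.
  by rewrite [RHS]mxE [X in _ = X + _]mxE [X in _ = _ * X + _]mxE mxE.
apply: (ker_presented_retract (s := mklin sl) (r := mklin rl)).
  by move=> x; apply/rowP => i; rewrite /= mxE ffunE.
exact: ker_presented_ffun.
Qed.

(** Both directions take a surjection S^n -> N over S and compare its kernel over the two rings: S^n
    is k-presented over R for all [k], so the kernel rule descends to S and the quotient rule goes
    back to R. *)
Lemma ker_presented_restr k (N : lmodType S) :
  ker_presented k (restr f N) <-> ker_presented k N.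
Proof.
split.
  elim: k N => [|k IH] N.
    move=> [n [g [gs _]]].
    exists n, (lincomb (fun i => g (delta_mx 0 i) : N)); split=> // y.
    (* R-generators also generate over S: push the coefficients forward along [f]. *)
    have [v <-] := gs y; exists (map_mx f v).
    by rewrite [RHS]linear_lincomb; apply: eq_bigr => i _; rewrite mxE.
  (* The induction hypothesis at [k] already makes [N] finitely generated over S, which provides the
     S-linear surjection. *)
  move=> h; have [n [g gs]] := ker_presented_fg (IH _ (ker_presented_pred h)).
  exists n, g; split=> //; apply: IH.
  apply: (ker_presented_ker (restr_short_exact (ker_short_exact gs))) h.
  exact: ker_presented_restr_free.
elim: k N => [|k IH] N [n [g [gs h]]].
  apply: (ker_presented0_quot (p := restr_map g)) => //.
  exact: ker_presented_restr_free.
apply: (ker_presented_quot (restr_short_exact (ker_short_exact gs))).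
  exact: IH.
exact: ker_presented_restr_free.
Qed.

End Restriction.

(** * Base change along S over R *)

Section BaseChange.
Context {R S : comPzRingType} (f : {rmorphism R -> S}).

Lemma bc_pureDl (N : lmodType S) s t (x : N) :
  bc_pure f (s + t) x = bc_pure f s x + bc_pure f t x.
Proof. by have [h _ _] := @pure_balanced R (restr f S^o) (restr f N); exact: h. Qed.

Lemma bc_pureDr (N : lmodType S) s (x y : N) :
  bc_pure f s (x + y) = bc_pure f s x + bc_pure f s y.
Proof. by have [_ h _] := @pure_balanced R (restr f S^o) (restr f N); exact: h. Qed.

Lemma bc_pureZ (N : lmodType S) r s (x : N) :
  bc_pure f (f r * s) x = bc_pure f s (f r *: x).
Proof. by have [_ _ h] := @pure_balanced R (restr f S^o) (restr f N); exact: h. Qed.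

Lemma bc_scaleE (N : lmodType S) s t (x : N) :
  s *: bc_pure f t x = bc_pure f (s * t) x.
Proof. exact: bc_scale_pure. Qed.

Lemma bc_pure_linear (N : lmodType S) s :
  linear ((fun x => bc_pure f s x) : restr f N -> restr f (base_change f N)).
Proof.
move=> r x y; apply: etrans (bc_pureDr _ _ _) _; congr (_ + _).
exact: etrans (esym (bc_pureZ r s x)) (esym (bc_scaleE (f r) s x)).
Qed.

(** The universal property for R-linear targets; R acts on the tensor product through the left
    factor, hence the second hypothesis on [phi]. *)
Lemma bc_lift (N : lmodType S) (Q : lmodType R)
    (phi : restr f S^o -> restr f N -> Q) :
  balanced phi -> (forall r t x, phi (r *: t) x = r *: phi t x) ->
  exists g : {linear restr f (base_change f N) -> Q},
    forall t x, g (bc_pure f t x) = phi t x.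
Proof.
move=> bal phiZ; pose g : restr f (base_change f N) -> Q := tens_lift phi.
have gD : {morph g : x y / x + y} := tens_liftD bal.
have gE (t : restr f S^o) (x : restr f N) : g (bc_pure f t x) = phi t x :=
  tens_lift_pure t x bal.
have g0 : g 0 = 0 by apply: (@addrI _ (g 0)); rewrite -gD !addr0.
suff l : linear g by exists (mklin l).
move=> r x y; rewrite gD; congr (_ + _).
elim/bc_ind: x => [|t m x IH]; first by rewrite scaler0 g0 scaler0.
rewrite scalerDr !gD scalerDr IH; congr (_ + _).
by rewrite -[r *: _]/(f r *: bc_pure f t m) bc_scaleE !gE -phiZ.
Qed.

(** A finite dual basis: the normalizing generators give a surjection R^m -> S, and projectivity
    splits it. *)
Lemma coordinates : finite_normalizing f -> @projective R (restr f S^o) ->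
  exists m (s : 'I_m -> restr f S^o) (c : {linear restr f S^o -> 'rV[R]_m}),
    cancel c (lincomb s).
Proof.
move=> [m [s [gen _]]] proj; pose s' i : restr f S^o := s i; exists m, s'.
have [|c hc] := proj _ _ (lincomb s') idfun; last by exists c.
apply/range_setT => x; have [r ->] := gen x; exists (\row_i r i).
by apply: eq_bigr => i _; rewrite mxE mulrC.
Qed.

(** After restricting both sides to R, each module is a retract of the other or of a finite power of
    it. The maps are [x] to [1 (x) x] and [t (x) x] to [t x] one way, [t (x) x] to [(c_i(t) x)_i]
    and [v] to the sum of the [s_i (x) v_i] the other way. *)
Lemma ker_presented_bc m (s : 'I_m -> restr f S^o)
    (c : {linear restr f S^o -> 'rV[R]_m}) k (N : lmodType S) :
  cancel c (lincomb s) ->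
  ker_presented k (base_change f N) <-> ker_presented k N.
Proof.
move=> cK.
have S_pres j : @ker_presented R j (restr f S^o).
  exact: ker_presented_retract cK (ker_presented_free _ _).
rewrite -!(ker_presented_restr S_pres); split.
  have [mu muE] : exists mu : {linear restr f (base_change f N) -> restr f N},
      forall t x, mu (bc_pure f t x) = (t : S) *: (x : N).
    apply: bc_lift => [|r t x]; last exact: (esym (scalerA (f r) (t : S) (x : N))).
    split=> [t t' x|t x x'|r t x]; [|exact: (scalerDr (t : S) (x : N) x')|].
      exact: (scalerDl (x : N) (t : S) t').
    rewrite -[RHS]/((t : S) *: (f r *: (x : N))) scalerA mulrC.
    exact: erefl.
  apply: (ker_presented_retract (s := mklin (bc_pure_linear 1)) (r := mu)) => x.
  by rewrite [LHS]muE scale1r.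
move=> hN; have hNm := ker_presented_ffun m hN.
have [u uE] : exists u : {linear restr f (base_change f N) ->
    {ffun 'I_m -> restr f N}},
    forall t x, u (bc_pure f t x) = [ffun i => c t 0 i *: (x : restr f N)].
  apply: bc_lift => [|r t x]; last first.
    by apply/ffunP => i; rewrite linearZ !ffunE mxE scalerA.
  split=> [t t' x|t x x'|r t x]; apply/ffunP => i; rewrite ?linearD ?linearZ.
  - by rewrite !ffunE mxE scalerDl.
  - by rewrite !ffunE scalerDr.
  - by rewrite !ffunE mxE mulrC scalerA.
have vl : linear (fun v : {ffun 'I_m -> restr f N} =>
    (\sum_i bc_pure f (s i) (v i)) : restr f (base_change f N)).
  move=> r x y; rewrite scaler_sumr -big_split; apply: eq_bigr => i _.
  by rewrite !ffunE; exact: bc_pure_linear.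
apply: (ker_presented_retract (s := u) (r := mklin vl)) hNm => x.
elim/bc_ind: x => [|t x y IH]; first by rewrite !linear0.
rewrite !linearD IH uE /=; congr (_ + _).
have p0 : bc_pure f 0 x = 0.
  by apply: (@addrI _ (bc_pure f 0 x)); rewrite -bc_pureDl !addr0.
(* On a pure tensor, expand [t] as the sum of the [c_i(t) s_i] and move the scalars across the
   tensor sign. *)
rewrite -[t in RHS]cK (big_morph _ (fun z z' => bc_pureDl z z' x) p0).
by apply: eq_bigr => i _; rewrite ffunE; exact: esym (bc_pureZ _ _ _).
Qed.

(** Flatness makes the canonical map into S (x) M injective, hence an isomorphism onto its image,
    which is [bc_submod f N]. *)
Lemma ker_presented_bc_submod (M : lmodType S) (N : submodClosed M) k :
  @flat R (restr f S^o) ->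
  ker_presented k (submod_type (bc_submod f N)) <->
  ker_presented k (base_change f (submod_type N)).
Proof.
move=> fl; pose v : {linear submod_type N -> M} := val.
pose w := mklin (@bc_map_linear R S f _ _ v).
have wi : injective w.
  have vi : injective (restr_map f v) by exact: val_inj.
  exact: (fl _ _ _ vi).
pose b : {linear submod_type (bc_submod f N) -> base_change f M} := val.
have [u hu] : exists u : {linear base_change f (submod_type N) ->
    submod_type (bc_submod f N)}, forall x, b (u x) = w x.
  apply: linear_factor; first exact: val_inj.
  move=> x; have wx : w x \in bc_submod f N by apply/asboolP; exists x.
  by exists (SubmodElt wx).
apply: iff_sym; apply: (ker_presented_iso _ (u := u)).
  by move=> x y /(congr1 b); rewrite !hu; exact: wi.
move=> y; have /asboolP[x _ xy] : b y \in bc_submod f N := valP y.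
by exists x; apply: val_inj; rewrite [LHS]hu.
Qed.

End BaseChange.

(** * From modules to classes of submodules *)

Lemma ker_presented_restr_submod (R S : pzRingType) (f : {rmorphism R -> S})
    (M : lmodType S) (N : submodClosed M) k :
  ker_presented k (submod_type (restr_submod f N)) <->
  ker_presented k (restr f (submod_type N)).
Proof.
pose v : {linear submod_type N -> M} := val.
pose b : {linear submod_type (restr_submod f N) -> restr f M} := val.
have [u hu] : exists u : {linear restr f (submod_type N) ->
    submod_type (restr_submod f N)}, forall x, b (u x) = v x.
  apply: (linear_factor (q := restr_map f v)); first exact: val_inj.
  move=> x; have wx : v x \in restr_submod f N by exact: (valP (x : submod_type N)).
  by exists (@SubmodElt R (restr f M) (restr_submod f N) (v x) wx).
apply: iff_sym; apply: (ker_presented_iso _ (u := u)).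
  by move=> x y /(congr1 b); rewrite !hu; exact: val_inj.
move=> y; have yN : (b y : M) \in N := valP y.
by exists (SubmodElt yN); apply: val_inj; rewrite [LHS]hu.
Qed.

Lemma coherent_image (R S : pzRingType) (M : lmodType R) (M' : lmodType S)
    (h : submodClosed M -> submodClosed M') (X : set (submodClosed M)) n :
  (forall k N, nat_presented k (submod_type (h N)) <->
     nat_presented k (submod_type N)) ->
  coherent n (h @` X)%classic <-> coherent n X.
Proof.
move=> hP.
(* The index -1, which arises when [n = 0], imposes nothing on either side. *)
have {}hP (k : int) N :
    presented k (submod_type (h N)) <-> presented k (submod_type N).
  by case: k => // k; exact: hP.
have cP k N : class_presented X k N <-> X N /\ presented k (submod_type (h N)).
  by split=> -[XN /hP].
split=> -[[N0 h0] h1]; split.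
- by case: h0 => -[N XN <-] /hP; exists N.
(* Only presentedness is pulled back from [h N]; membership of [N] in [X] is already at hand, so [h]
   may identify submodules. *)
- move=> N /cP[XN p]; apply/cP; split=> //.
  by apply: (h1 (h N) _).2; split=> //; exists N.
- by case/cP: h0 => XN p; exists (h N0); split=> //; exists N0.
- move=> _ [[N XN <-] p]; split; first by exists N.
  by have /cP[] : class_presented X n N by apply: h1; apply/cP.
Qed.

Theorem theorem2p12 (R S : comPzRingType) (f : {rmorphism R -> S})
    (hf : almost_excellent f) (n : nat) (M : lmodType S)
    (X : set (submodClosed M)) :
  (coherent n (restr_class f X) <-> coherent n (bc_class f X)) /\
  (coherent n (bc_class f X) <-> coherent n X).
Proof.
case: hf => _ fin fl proj _.
have [m [s [c cK]]] := coordinates fin proj.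
have bcP : coherent n (bc_class f X) <-> coherent n X.
  apply: coherent_image => k N.
  by rewrite !nat_presentedP ker_presented_bc_submod // (ker_presented_bc _ _ cK).
split=> //; rewrite bcP; apply: coherent_image => k N.
rewrite !nat_presentedP ker_presented_restr_submod ker_presented_restr // => j.
exact: ker_presented_retract cK (ker_presented_free _ _).
Qed.
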